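(* Let $p\geq 3$ be a prime, let $a,b,c\in\mathbb{Q}_p$ with $a\neq c$ and $c^2-ac+b\neq 0$, let $f(x)=\frac{x^2+ax+b}{x+c}$ for $x\in\mathbb{Q}_p$, $x\neq -c$, let $x_0=\frac{b}{c-a}$ be its unique fixed point, and put $\alpha=|x_0+a|_p$, $\beta=|x_0+c|_p$. Let $r>0$ be a value of the $p$-adic norm. 1. If $r\in I_1$ (that is, $\alpha\neq\beta$ and $r>\max\{\alpha,\beta\}$), then the dynamical system $(S_r(x_0),f,\mu)$ is not ergodic. 2. If $r\in I_2$ (that is, $\alpha=\beta$ and $r\neq\beta$), then: (2.1) if $|a-c|_p<\beta$, then the dynamical system $(S_r(x_0),f,\mu)$ is not ergodic; (2.2) if $|a-c|_p=\beta$, then the dynamical system $(S_r(x_0),f,\mu)$ is not ergodic for $r>\beta$.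
   Context: Here $|\cdot|_p$ is the $p$-adic norm on $\mathbb{Q}_p$ normalized by $|p|_p=1/p$. For $s\in\mathbb{Q}_p$ and $\rho>0$, $U_\rho(s)=\{x\in\mathbb{Q}_p:|x-s|_p\le\rho\}$ and $S_\rho(s)=\{x\in\mathbb{Q}_p:|x-s|_p=\rho\}$. A (nonzero) value of the $p$-adic norm means a number of the form $p^k$, $k\in\mathbb{Z}$. $I_1=\{r: r>\max\{\alpha,\beta\}\}$ if $\alpha\neq\beta$ (and $I_1=\emptyset$ otherwise); $I_2=\{r: r\neq\beta\}$ if $\alpha=\beta$ (and $I_2=\emptyset$ otherwise), where $r$ ranges over positive reals. For $r\in I_1\cup I_2$, one has $-c\notin S_r(x_0)$ and $f(S_r(x_0))\subset S_r(x_0)$. $\mu$ is the normalized Haar measure on the Borel $\sigma$-algebra $\mathcal{B}$ of $S_r(x_0)$: the restriction to $S_r(x_0)$ of the Haar measure $\bar\mu$ on $\mathbb{Q}_p$ with $\bar\mu(U_\rho(s))=\rho$ for every $\rho\in p^{\mathbb{Z}}$, divided by $\bar\mu(S_r(x_0))=r(1-\frac1p)$. The map $f$ preserves $\mu$. The system $(S_r(x_0),f,\mu)$ is called ergodic if every invariant set $V\in\mathcal{B}$ (i.e. with $f(V)\subset V$) satisfies $\mu(V)=0$ or $\mu(V)=1$. *)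

(* Defs.v *)
From HB Require Import structures.
From mathcomp Require Import all_boot all_order all_algebra ring_quotient.
From mathcomp Require Import all_classical all_reals all_analysis.
From mathcomp Require Import ring lra zify.

Set Implicit Arguments.
Unset Strict Implicit.
Unset Printing Implicit Defensive.

Import Order.TTheory GRing.Theory Num.Theory.
Import numFieldNormedType.Exports.

Local Open Scope classical_set_scope.
Local Open Scope ring_scope.

(* The norms below take their values in an abstract model R of the real
   numbers. *)
Section RatNorm.
Variables (R : realType) (p : nat).

Definition rat_pval (q : rat) : int :=
  (logn p `|numq q|%N)%:Z - (logn p `|denq q|%N)%:Z.

(* |q|_p = p ^ (- v_p(q)), so that |p|_p = 1/p. *)
Definition rat_pnorm (q : rat) : R :=
  if q == 0 then 0 else p%:R ^ (- rat_pval q).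

End RatNorm.

Section RatNormTheory.
Variables (R : realType) (p : nat) (p_prime : prime p).
Local Notation pv := (rat_pval p).
Local Notation pn := (rat_pnorm R p).
Implicit Types (q s : rat).

Let p_gt1 : (1 : R) < p%:R.
Proof. by rewrite ltr1n prime_gt1. Qed.

Let p_gt0 : (0 : R) < p%:R.
Proof. exact: lt_trans ltr01 p_gt1. Qed.

Lemma rat_pnorm0 : pn 0 = 0.
Proof. by rewrite /rat_pnorm eqxx. Qed.

Lemma rat_pnorm_neq0 q : q != 0 -> pn q = p%:R ^ (- pv q).
Proof. by rewrite /rat_pnorm => /negPf ->. Qed.

Lemma rat_pnorm_gt0 q : (0 < pn q) = (q != 0).
Proof.
by rewrite /rat_pnorm; case: ifP; rewrite ?ltxx // => _; rewrite exprz_gt0.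
Qed.

Lemma rat_pnorm_ge0 q : 0 <= pn q.
Proof. by rewrite /rat_pnorm; case: ifP => // _; rewrite exprz_ge0 // ltW. Qed.

Lemma rat_pnorm_eq0 q : (pn q == 0) = (q == 0).
Proof.
by have := rat_pnorm_gt0 q; rewrite lt_def rat_pnorm_ge0 andbT => /negb_inj.
Qed.

Lemma rat_pval_frac (n d : int) : n != 0 -> d != 0 ->
  pv (n%:~R / d%:~R) = (logn p `|n|%N)%:Z - (logn p `|d|%N)%:Z.
Proof.
move=> n0 d0; set q := n%:~R / d%:~R.
have q0 : q != 0 by rewrite mulf_neq0 ?invr_eq0 ?intr_eq0.
have E : numq q * d = n * denq q.
  apply: (@intr_inj rat); rewrite !rmorphM /= numqE /q.
  by field; rewrite intr_eq0.
have := congr1 (fun z => logn p `|z|%N) E.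
rewrite /= !abszM !lognM ?absz_gt0 ?numq_eq0 ?denq_eq0 // /rat_pval; lia.
Qed.

Lemma rat_pnormM q s : pn (q * s) = pn q * pn s.
Proof.
have [->|q0] := eqVneq q 0; first by rewrite !(mul0r, rat_pnorm0).
have [->|s0] := eqVneq s 0; first by rewrite !(mulr0, rat_pnorm0).
rewrite !rat_pnorm_neq0 ?mulf_neq0 // -expfzDr ?gt_eqF //.
congr (_ ^ _).
have -> : q * s = (numq q * numq s)%:~R / (denq q * denq s)%:~R.
  by rewrite -{1}[q]divq_num_den -{1}[s]divq_num_den !rmorphM /= mulf_div.
rewrite rat_pval_frac ?mulf_neq0 ?numq_eq0 ?denq_eq0 //.
rewrite !abszM !lognM ?absz_gt0 ?numq_eq0 ?denq_eq0 // /rat_pval; lia.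
Qed.

Lemma rat_pnorm1 : pn 1 = 1.
Proof. by rewrite /rat_pnorm oner_eq0 /rat_pval /= !logn1. Qed.

Lemma rat_pnormN q : pn (- q) = pn q.
Proof. by rewrite /rat_pnorm /rat_pval oppr_eq0 numqN denqN abszN. Qed.

Lemma rat_pnormV q : pn q^-1 = (pn q)^-1.
Proof.
have [->|q0] := eqVneq q 0; first by rewrite !(invr0, rat_pnorm0).
have n0 : pn q != 0 by rewrite rat_pnorm_eq0.
by apply: (mulIf n0); rewrite -rat_pnormM !mulVf // rat_pnorm1.
Qed.

Lemma rat_pnormD_max q s : pn (q + s) <= Num.max (pn q) (pn s).
Proof.
have [->|q0] := eqVneq q 0; first by rewrite add0r le_max lexx orbT.
have [->|s0] := eqVneq s 0; first by rewrite addr0 le_max lexx.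
have [->|qs0] := eqVneq (q + s) 0.
  by rewrite rat_pnorm0 le_max rat_pnorm_ge0.
rewrite !rat_pnorm_neq0 // le_max !ler_eXz2l // !lerN2.
pose a : int := numq q * denq s; pose b : int := numq s * denq q.
pose d : int := denq q * denq s.
have d0 : d != 0 by rewrite mulf_neq0 ?denq_eq0.
have a0 : a != 0 by rewrite mulf_neq0 ?numq_eq0 ?denq_eq0.
have b0 : b != 0 by rewrite mulf_neq0 ?numq_eq0 ?denq_eq0.
have Eq : q = a%:~R / d%:~R.
  rewrite -{1}[q]divq_num_den !rmorphM /=.
  by field; rewrite !intr_eq0 !denq_eq0.
have Es : s = b%:~R / d%:~R.
  rewrite -{1}[s]divq_num_den !rmorphM /=.
  by field; rewrite !intr_eq0 !denq_eq0.
have Eqs : q + s = (a + b)%:~R / d%:~R by rewrite Eq Es -mulrDl rmorphD.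
have ab0 : a + b != 0.
  by apply: contraNneq qs0 => h; rewrite Eqs h mul0r.
rewrite Eqs {1}Eq {1}Es !rat_pval_frac //.
suff: (minn (logn p `|a|) (logn p `|b|) <= logn p `|(a + b)%R|)%N by lia.
rewrite -pfactor_dvdn ?absz_gt0 //.
suff: ((p ^ minn (logn p `|a|) (logn p `|b|))%N%:Z %| a + b)%Z by [].
by apply: rpredD; rewrite dvdzE /= pfactor_dvdn ?absz_gt0 // ?geq_minl ?geq_minr.
Qed.

Lemma rat_pnormD q s : pn (q + s) <= pn q + pn s.
Proof.
apply: le_trans (rat_pnormD_max q s) _.
by rewrite ge_max lerDl lerDr !rat_pnorm_ge0.
Qed.

Lemma rat_pnormB q s : pn (q - s) = pn (s - q).
Proof. by rewrite -rat_pnormN opprB. Qed.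

Lemma rat_pnorm_dist q s : `|pn q - pn s| <= pn (q - s).
Proof.
rewrite ler_norml; apply/andP; split.
  by have := rat_pnormD (s - q) q; rewrite subrK -rat_pnormB; lra.
by have := rat_pnormD (q - s) s; rewrite subrK; lra.
Qed.

End RatNormTheory.

Section PadicCauchy.
Variables (R : realType) (p : nat) (p_prime : prime p).
Local Notation pn := (rat_pnorm R p).
Implicit Types (u v : nat -> rat).

Definition rat_pcauchy u : Prop :=
  forall e : R, 0 < e ->
    exists N, forall m n, (N <= m)%N -> (N <= n)%N -> pn (u m - u n) < e.

Definition rat_pnull u : Prop := (fun n => pn (u n)) @ \oo --> (0 : R).

Lemma rat_pnullP u : rat_pnull u <->
  forall e : R, 0 < e -> exists N, forall n, (N <= n)%N -> pn (u n) < e.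
Proof.
split=> [/cvgrPdist_lt h e e0|h].
  have [N _ HN] := h e e0; exists N => n Nn.
  by have := HN n Nn; rewrite /= sub0r normrN ger0_norm ?rat_pnorm_ge0.
apply/cvgrPdist_lt => e e0; have [N HN] := h e e0; exists N => // n Nn /=.
by rewrite sub0r normrN ger0_norm ?rat_pnorm_ge0 // HN.
Qed.

Lemma rat_pcauchy_cst q : rat_pcauchy (fun=> q).
Proof. by move=> e e0; exists 0%N => m n _ _; rewrite subrr rat_pnorm0. Qed.

Lemma rat_pcauchyB u v :
  rat_pcauchy u -> rat_pcauchy v -> rat_pcauchy (fun n => u n - v n).
Proof.
move=> cu cv e e0.
have [N HN] := cu e e0; have [M HM] := cv e e0.
exists (maxn N M) => m n; rewrite !geq_max => /andP[Nm Mm] /andP[Nn Mn].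
have -> : u m - v m - (u n - v n) = (u m - u n) + - (v m - v n) by ring.
apply: le_lt_trans (rat_pnormD_max _ p_prime _ _) _.
by rewrite gt_max rat_pnormN HN // HM.
Qed.

Lemma rat_pcauchy_bounded u : rat_pcauchy u ->
  exists2 B : R, 0 < B & exists N, forall n, (N <= n)%N -> pn (u n) <= B.
Proof.
move=> cu; have [N HN] := cu 1 ltr01.
exists (pn (u N) + 1); first by rewrite ltr_wpDl ?rat_pnorm_ge0.
exists N => n Nn; have := rat_pnormD R p_prime (u N) (u n - u N).
rewrite addrC subrK => /le_trans; apply.
by rewrite lerD2l ltW // HN.
Qed.

Lemma rat_pcauchyM u v :
  rat_pcauchy u -> rat_pcauchy v -> rat_pcauchy (fun n => u n * v n).
Proof.
move=> cu cv e e0.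
have [A A0 [N1 HA]] := rat_pcauchy_bounded cu.
have [B B0 [N2 HB]] := rat_pcauchy_bounded cv.
have [N HN] := cu (e / B) (divr_gt0 e0 B0).
have [M HM] := cv (e / A) (divr_gt0 e0 A0).
exists (maxn (maxn N M) (maxn N1 N2)) => m n.
rewrite !geq_max => /andP[/andP[Nm Mm] /andP[N1m N2m]].
move=> /andP[/andP[Nn Mn] /andP[N1n N2n]].
have -> : u m * v m - u n * v n = (u m - u n) * v m + u n * (v m - v n) by ring.
apply: le_lt_trans (rat_pnormD_max _ p_prime _ _) _.
rewrite gt_max !rat_pnormM //; apply/andP; split.
  apply: (@le_lt_trans _ _ (pn (u m - u n) * B)).
    by rewrite ler_wpM2l ?rat_pnorm_ge0 // HB.
  by rewrite -ltr_pdivlMr // HN.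
apply: (@le_lt_trans _ _ (A * pn (v m - v n))).
  by rewrite ler_wpM2r ?rat_pnorm_ge0 // HA.
by rewrite mulrC -ltr_pdivlMr // HM.
Qed.

Lemma rat_pnull_cauchy u : rat_pnull u -> rat_pcauchy u.
Proof.
move=> /rat_pnullP nu e e0; have [N HN] := nu e e0.
exists N => m n Nm Nn; apply: le_lt_trans (rat_pnormD_max _ p_prime _ _) _.
by rewrite gt_max rat_pnormN !HN.
Qed.

Lemma rat_pnullB u v :
  rat_pnull u -> rat_pnull v -> rat_pnull (fun n => u n - v n).
Proof.
move=> /rat_pnullP nu /rat_pnullP nv; apply/rat_pnullP => e e0.
have [N HN] := nu e e0; have [M HM] := nv e e0.
exists (maxn N M) => n; rewrite !geq_max => /andP[Nn Mn].
apply: le_lt_trans (rat_pnormD_max _ p_prime _ _) _.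
by rewrite gt_max rat_pnormN HN // HM.
Qed.

Lemma rat_pnullMl u v :
  rat_pcauchy u -> rat_pnull v -> rat_pnull (fun n => u n * v n).
Proof.
move=> /rat_pcauchy_bounded[A A0 [N1 HA]] /rat_pnullP nv.
apply/rat_pnullP => e e0.
have [M HM] := nv (e / A) (divr_gt0 e0 A0).
exists (maxn N1 M) => n; rewrite !geq_max => /andP[Nn Mn].
rewrite rat_pnormM //; apply: (@le_lt_trans _ _ (A * pn (v n))).
  by rewrite ler_wpM2r ?rat_pnorm_ge0 // HA.
by rewrite mulrC -ltr_pdivlMr // HM.
Qed.

(* An ultrametric Cauchy sequence that does not tend to 0 has eventually
   constant norm. *)
Lemma rat_pcauchy_norm_stable u : rat_pcauchy u -> ~ rat_pnull u ->
  exists2 q : rat, q != 0 &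
    exists N, forall n, (N <= n)%N -> pn (u n) = pn q.
Proof.
move=> cu nu.
have [e e0 He] : exists2 e : R, 0 < e &
    forall N, exists2 n, (N <= n)%N & e <= pn (u n).
  apply: contrapT => h; apply: nu; apply/rat_pnullP => e e0.
  apply: contrapT => h'; apply: h; exists e => // N.
  apply: contrapT => h''; apply: h'; exists N => n Nn.
  by rewrite ltNge; apply/negP => ?; apply: h''; exists n.
have [N HN] := cu e e0; have [n0 Nn0 Hn0] := He N.
exists (u n0); first by rewrite -(rat_pnorm_gt0 R p_prime) (lt_le_trans e0).
exists N => n Nn; have d := HN _ _ Nn Nn0.
apply/eqP; rewrite eq_le; apply/andP; split.
  have := rat_pnormD_max R p_prime (u n - u n0) (u n0).
  by rewrite subrK => /le_trans -> //; rewrite ge_max lexx (ltW (lt_le_trans d _)).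
have := rat_pnormD_max R p_prime (u n0 - u n) (u n).
rewrite subrK le_max => /orP[|//].
by rewrite rat_pnormB // leNgt (lt_le_trans d).
Qed.

Lemma rat_pcauchyV u : rat_pcauchy u -> ~ rat_pnull u ->
  rat_pcauchy (fun n => (u n)^-1).
Proof.
move=> cu /(rat_pcauchy_norm_stable cu)[q q0 [M HM]] e e0.
have c0 : 0 < pn q by rewrite rat_pnorm_gt0.
have [N HN] := cu (e * (pn q * pn q)) (mulr_gt0 e0 (mulr_gt0 c0 c0)).
exists (maxn N M) => m n; rewrite !geq_max => /andP[Nm Mm] /andP[Nn Mn].
have um : u m != 0 by rewrite -(rat_pnorm_gt0 R p_prime) HM.
have un : u n != 0 by rewrite -(rat_pnorm_gt0 R p_prime) HM.
have -> : (u m)^-1 - (u n)^-1 = (u n - u m) * (u m)^-1 * (u n)^-1.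
  by field; rewrite um un.
rewrite !rat_pnormM // !rat_pnormV // !HM // -mulrA -invfM.
by rewrite ltr_pdivrMr ?mulr_gt0 // HN.
Qed.

Lemma rat_pcauchy_norm_cvg u : rat_pcauchy u -> cvgn (fun n => pn (u n)).
Proof.
move=> cu; have [nu|nu] := pselect (rat_pnull u); first by apply/cvg_ex; exists 0.
have [q _ [N HN]] := rat_pcauchy_norm_stable cu nu.
apply/cvg_ex; exists (pn q); apply/cvgrPdist_lt => e e0.
by exists N => // n Nn /=; rewrite HN // subrr normr0.
Qed.

End PadicCauchy.

(* Q_p is the completion of the rationals for |.|_p: the ring of |.|_p-Cauchy
   sequences modulo the ideal of sequences tending to 0.  Primality of p is a
   parameter of the type because the quotient is a field only for prime p. *)
Section PadicRing.
Variables (R : realType) (p : nat) (p_prime : prime p).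
Local Notation pn := (rat_pnorm R p).

Definition pcauchy_pred of prime p : {pred nat -> rat} :=
  fun u => `[< rat_pcauchy R p u >].

Lemma pcauchy_pred_subring : subring_closed (pcauchy_pred p_prime).
Proof.
split.
- by apply/asboolP; exact: rat_pcauchy_cst.
- by move=> u v /asboolP cu /asboolP cv; apply/asboolP; exact: rat_pcauchyB.
- by move=> u v /asboolP cu /asboolP cv; apply/asboolP; exact: rat_pcauchyM.
Qed.

HB.instance Definition _ :=
  GRing.isSubringClosed.Build (nat -> rat) (pcauchy_pred p_prime)
    pcauchy_pred_subring.

Record pcauchy_seq := PCauchySeq {
  pcauchy_fun :> nat -> rat;
  pcauchy_funP : pcauchy_fun \in pcauchy_pred p_prime }.

HB.instance Definition _ := [isSub for pcauchy_fun].
HB.instance Definition _ := [Choice of pcauchy_seq by <:].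
HB.instance Definition _ := [SubChoice_isSubComNzRing of pcauchy_seq by <:].

Lemma pcauchy_seqP (u : pcauchy_seq) : rat_pcauchy R p u.
Proof. exact/asboolP/pcauchy_funP. Qed.

Definition pnull_pred : {pred pcauchy_seq} := fun u => `[< rat_pnull R p u >].

Lemma pnull_pred_idealr : idealr_closed pnull_pred.
Proof.
split.
- by apply/asboolP/rat_pnullP => e e0; exists 0%N => n _; rewrite rat_pnorm0.
- apply/asboolP => /rat_pnullP /(_ 1 ltr01)[N /(_ N (leqnn N))].
  by rewrite rat_pnorm1 ltxx.
- move=> a u v /asboolP nu /asboolP nv; apply/asboolP.
  have -> : (a * u + v : pcauchy_seq) = (fun n => a n * u n - - v n) :> (nat -> rat).
    by apply/funext => n; rewrite opprK.
  apply: rat_pnullB => //; first exact: rat_pnullMl (pcauchy_seqP a) nu.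
  apply/rat_pnullP => e e0; have /rat_pnullP/(_ e e0)[N HN] := nv.
  by exists N => n Nn; rewrite rat_pnormN HN.
Qed.

HB.instance Definition _ := isIdealr.Build pcauchy_seq pnull_pred pnull_pred_idealr.

Definition padic := {ideal_quot pnull_pred}.

HB.instance Definition _ := Choice.on padic.
HB.instance Definition _ := GRing.ComNzRing.on padic.
HB.instance Definition _ := isPointed.Build padic 0.

Definition padic_of_seq (u : pcauchy_seq) : padic := (\pi_({ideal_quot pnull_pred}) u)%qT.

Lemma padic_of_seq0 : padic_of_seq 0 = 0.
Proof. by rewrite /padic_of_seq piE. Qed.

Lemma padic_of_seq1 : padic_of_seq 1 = 1.
Proof. by rewrite /padic_of_seq piE. Qed.

Lemma padic_of_seqM u v : padic_of_seq (u * v) = padic_of_seq u * padic_of_seq v.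
Proof. by rewrite /padic_of_seq; rewrite !piE. Qed.

Lemma padic_of_seqB u v : padic_of_seq (u - v) = padic_of_seq u - padic_of_seq v.
Proof. by rewrite /padic_of_seq; rewrite !piE. Qed.

Lemma padic_of_seq_surj (x : padic) : {u | x = padic_of_seq u}.
Proof. by exists (repr x); rewrite /padic_of_seq reprK. Qed.

Lemma padic_of_seq_eq u v :
  padic_of_seq u = padic_of_seq v <-> rat_pnull R p (u - v).
Proof.
by split=> [/eqP|h]; [|apply/eqP]; rewrite /padic_of_seq -Quotient.idealrBE;
  [move=> /asboolP|apply/asboolP].
Qed.

End PadicRing.

Section PadicField.
Variables (R : realType) (p : nat) (p_prime : prime p).
Local Notation pn := (rat_pnorm R p).
Local Notation Qp := (padic R p_prime).

Lemma padic_inv_ex (x : Qp) : exists y : Qp, if x == 0 then y = 0 else y * x = 1.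
Proof.
have [x0|x0] := eqVneq x 0; first by exists 0.
have [u xu] := padic_of_seq_surj x.
have nu : ~ rat_pnull R p u.
  move=> nu; move/eqP: x0; apply; rewrite xu.
  rewrite -(padic_of_seq0 R p_prime); apply: (padic_of_seq_eq _ _).2.
  by rewrite subr0.
have cv := rat_pcauchyV p_prime (pcauchy_seqP u) nu.
pose v := @PCauchySeq R p p_prime (fun n => (u n)^-1) (asboolT cv).
exists (padic_of_seq v); rewrite xu -padic_of_seqM -(padic_of_seq1 R p_prime); apply: (padic_of_seq_eq _ _).2.
have [q q0 [N HN]] := rat_pcauchy_norm_stable p_prime (pcauchy_seqP u) nu.
apply/rat_pnullP => e e0; exists N => n Nn /=.
have un : u n != 0 by rewrite -(rat_pnorm_gt0 R p_prime) HN ?rat_pnorm_gt0.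
rewrite -[X in pn X]/((u n)^-1 * u n - 1).
by rewrite mulVf // subrr rat_pnorm0.
Qed.

Definition padic_inv (x : Qp) : Qp := sval (cid (padic_inv_ex x)).

Lemma padic_mulVf (x : Qp) : x != 0 -> padic_inv x * x = 1.
Proof. by rewrite /padic_inv; case: cid => y /=; case: ifP. Qed.

Lemma padic_invr0 : padic_inv 0 = 0.
Proof. by rewrite /padic_inv; case: cid => y /=; rewrite eqxx. Qed.

HB.instance Definition _ :=
  GRing.ComNzRing_isField.Build Qp padic_mulVf padic_invr0.

(* |x|_p = lim |u_n|_p for any Cauchy sequence u representing x; see
   padic_norm_cvg for the independence of the representative. *)
Definition padic_norm (x : Qp) : R :=
  limn (fun n => pn ((repr x : pcauchy_seq R p_prime) n)).

Lemma padic_norm_cvg (u : pcauchy_seq R p_prime) :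
  (fun n => pn (u n)) @ \oo --> padic_norm (padic_of_seq u).
Proof.
have cu := rat_pcauchy_norm_cvg p_prime (pcauchy_seqP u).
suff -> : padic_norm (padic_of_seq u) = limn (fun n => pn (u n)) by exact: cu.
set v := (repr (padic_of_seq u)).
have vu : padic_of_seq v = padic_of_seq u by rewrite /padic_of_seq reprK.
have cv := rat_pcauchy_norm_cvg p_prime (pcauchy_seqP v).
apply/eqP; rewrite -subr_eq0; apply/eqP.
rewrite /padic_norm -limB //; apply: cvg_lim => //.
move/padic_of_seq_eq: vu => /rat_pnullP vu.
apply/cvgrPdist_lt => e e0; have [N HN] := vu e e0; exists N => // n Nn /=.
rewrite sub0r normrN; apply: le_lt_trans (HN n Nn).
exact: rat_pnorm_dist.
Qed.
Arguments padic_norm_cvg : clear implicits.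

Lemma padic_norm_ge0 (x : Qp) : 0 <= padic_norm x.
Proof.
have [u ->] := padic_of_seq_surj x.
apply: (cvgr_to_ge (padic_norm_cvg u)).
by near=> n; exact: rat_pnorm_ge0.
Unshelve. all: by end_near. Qed.

Lemma padic_norm0_eq0 (x : Qp) : padic_norm x = 0 -> x = 0.
Proof.
have [u ->] := padic_of_seq_surj x => u0.
rewrite -(padic_of_seq0 R p_prime); apply: (padic_of_seq_eq _ _).2.
by rewrite subr0 /rat_pnull -u0; exact: padic_norm_cvg.
Qed.

Definition padic_of_rat (q : rat) : Qp :=
  padic_of_seq (PCauchySeq (asboolT (@rat_pcauchy_cst R p q))).

Lemma padic_norm_rat (q : rat) : padic_norm (padic_of_rat q) = pn q.
Proof.
have /= h := padic_norm_cvg (PCauchySeq (asboolT (@rat_pcauchy_cst R p q))).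
by rewrite -(cvg_lim _ h) // lim_cst.
Qed.

Lemma padic_norm0 : padic_norm 0 = 0.
Proof.
have -> : 0 = padic_of_rat 0.
  by rewrite -padic_of_seq0; congr padic_of_seq; apply: val_inj.
by rewrite padic_norm_rat rat_pnorm0.
Qed.

Lemma padic_normM (x y : Qp) : padic_norm (x * y) = padic_norm x * padic_norm y.
Proof.
have [u ->] := padic_of_seq_surj x; have [v ->] := padic_of_seq_surj y.
rewrite -padic_of_seqM; rewrite -(cvg_lim _ (padic_norm_cvg (u * v))) //; apply: cvg_lim => //.
have -> : (fun n => pn ((u * v : pcauchy_seq R p_prime) n)) =
          (fun n => pn (u n) * pn (v n)).
  by apply/funext => n; rewrite -rat_pnormM.
by apply: cvgM; exact: padic_norm_cvg.
Qed.

Lemma padic_normD_max (x y : Qp) :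
  padic_norm (x + y) <= Num.max (padic_norm x) (padic_norm y).
Proof.
have [u ->] := padic_of_seq_surj x; have [v ->] := padic_of_seq_surj y.
have -> : padic_of_seq u + padic_of_seq v = padic_of_seq (u + v).
  by rewrite /padic_of_seq !piE.
have cu := padic_norm_cvg u; have cv := padic_norm_cvg v.
apply: (ler_cvg_to (padic_norm_cvg (_ + _))); last first.
  by near=> n; exact: rat_pnormD_max p_prime (u n) (v n).
rewrite maxr_absE; under eq_fun do rewrite maxr_absE.
apply: cvgMl; apply: cvgD; first exact: cvgD.
by apply: cvg_norm; exact: cvgB.
Unshelve. all: by end_near. Qed.

Lemma padic_normN (x : Qp) : padic_norm (- x) = padic_norm x.
Proof.
have [u ->] := padic_of_seq_surj x.
have -> : - padic_of_seq u = padic_of_seq (- u).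
  by rewrite /padic_of_seq !piE.
rewrite -(cvg_lim _ (padic_norm_cvg (- u))) //; apply: cvg_lim => //.
have -> : (fun n => pn ((- u : pcauchy_seq R p_prime) n)) = (fun n => pn (u n)).
  by apply/funext => n; rewrite -[LHS]rat_pnormN opprK.
exact: padic_norm_cvg.
Qed.

Lemma padic_normD (x y : Qp) :
  padic_norm (x + y) <= padic_norm x + padic_norm y.
Proof.
apply: le_trans (padic_normD_max x y) _.
by rewrite ge_max lerDl lerDr !padic_norm_ge0.
Qed.

End PadicField.
Arguments padic_norm_cvg {R p p_prime} u.

Section PadicMetric.
Variables (R : realType) (p : nat) (p_prime : prime p).
Local Notation Qp := (padic R p_prime).
Implicit Types x y z : Qp.

Definition padic_dist x y : R := padic_norm (x - y).

Let padic_distxx x : padic_dist x x = 0.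
Proof. by rewrite /padic_dist subrr padic_norm0. Qed.

Let padic_dist_eq0 x y : padic_dist x y = 0 -> x = y.
Proof. by move=> /padic_norm0_eq0 /eqP; rewrite subr_eq0 => /eqP. Qed.

Let padic_dist_sym x y : padic_dist x y = padic_dist y x.
Proof. by rewrite /padic_dist -padic_normN opprB. Qed.

Let padic_dist_triangle y x z :
  padic_dist x z <= padic_dist x y + padic_dist y z.
Proof.
rewrite /padic_dist; have -> : x - z = (x - y) + (y - z) by ring.
exact: padic_normD.
Qed.

HB.instance Definition _ := isMetric.Build R Qp
  padic_distxx padic_dist_eq0 padic_dist_sym padic_dist_triangle.

HB.instance Definition _ :=
  Measurable.copy Qp (g_sigma_algebraType (@open Qp)).

End PadicMetric.

Section Dynamics.
Variables (R : realType) (p : nat) (p_prime : prime p).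
Local Notation Qp := (padic R p_prime).

Definition padic_value (r : R) : Prop := exists k : int, r = p%:R ^ k.

(* U_rho(s); the library's closed_ball is the closure of the open ball, which
   is strictly smaller when rho is a value of the norm. *)
Definition padic_ball (s : Qp) (rho : R) : set Qp :=
  [set x | padic_norm (x - s) <= rho].

Definition padic_sphere (s : Qp) (rho : R) : set Qp :=
  [set x | padic_norm (x - s) = rho].

Lemma padic_norm_value (x : Qp) : x != 0 -> padic_value (padic_norm x).
Proof.
have [u ->] := padic_of_seq_surj x => u0.
have nu : ~ rat_pnull R p u.
  move=> nu; move/eqP: u0; apply; rewrite -(padic_of_seq0 R p_prime).
  by apply: (padic_of_seq_eq _ _).2; rewrite subr0.
have [q q0 [N HN]] := rat_pcauchy_norm_stable p_prime (pcauchy_seqP u) nu.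
exists (- rat_pval p q); rewrite -rat_pnorm_neq0 //.
rewrite -(cvg_lim _ (padic_norm_cvg u)) //; apply: cvg_lim => //.
apply/cvgrPdist_lt => e e0.
by exists N => // n Nn /=; rewrite HN // subrr normr0.
Qed.

Lemma padic_ball_open (s : Qp) (rho : R) : 0 < rho -> open (padic_ball s rho).
Proof.
move=> rho0; rewrite openE => x xs; apply/nbhs_ballP; exists rho => //= y.
rewrite ballEmdist /= => xy.
have -> : padic_ball s rho y = (padic_norm ((y - x) + (x - s)) <= rho).
  by rewrite /padic_ball /= addrA subrK.
apply: le_trans (padic_normD_max _ _) _.
by rewrite ge_max xs andbT -padic_normN opprB ltW.
Qed.

Lemma measurable_padic_ball (s : Qp) (rho : R) :
  0 < rho -> measurable (padic_ball s rho).
Proof. by move=> rho0; apply: sub_sigma_algebra; exact: padic_ball_open. Qed.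

Lemma padic_sphereE (s : Qp) (r : R) : padic_value r ->
  padic_sphere s r = padic_ball s r `\` padic_ball s (r / p%:R).
Proof.
move=> [k ->]; have p0 : (0 : R) < p%:R by rewrite ltr0n prime_gt0.
have p1 : (1 : R) < p%:R by rewrite ltr1n prime_gt1.
have -> : p%:R ^ k / p%:R = p%:R ^ (k - 1) :> R.
  by rewrite expfzDr ?gt_eqF // exprN1.
apply/seteqP; split=> x; rewrite /padic_sphere /padic_ball /=.
  by move=> ->; split=> //; rewrite ler_eXz2l //; apply/negP; lia.
move=> [le1 /negP]; rewrite -ltNge => lt1.
have xs : x - s != 0.
  apply: contraTneq lt1 => ->.
  by rewrite padic_norm0 -leNgt exprz_ge0 // ltW.
have [j jE] := padic_norm_value xs; move: le1 lt1; rewrite jE.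
by rewrite ler_eXz2l // ltr_eXz2l // => ? ?; congr (_ ^ _); lia.
Qed.

(* Together the two clauses single out one Borel measure: the Haar measure of
   (Q_p, +) normalized by U_rho(s) |-> rho for rho in p^Z. *)
Definition is_padic_haar (mubar : {measure set Qp -> \bar R}) : Prop :=
  (forall (s : Qp) (A : set Qp), measurable A ->
    mubar [set x + s | x in A] = mubar A) /\
  (forall (s : Qp) (rho : R), padic_value rho ->
    mubar (padic_ball s rho) = rho%:E).

Lemma padic_haar_sphere (mubar : {measure set Qp -> \bar R}) (s : Qp) (r : R) :
  is_padic_haar mubar -> padic_value r ->
  mubar (padic_sphere s r) = (r * (1 - p%:R^-1))%:E.
Proof.
move=> [_ mub] r_value; have p0 : (0 : R) < p%:R by rewrite ltr0n prime_gt0.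
have p1 : (1 : R) < p%:R by rewrite ltr1n prime_gt1.
have r0 : 0 < r by have [k ->] := r_value; rewrite exprz_gt0.
have r'_value : padic_value (r / p%:R).
  by have [k ->] := r_value; exists (k - 1); rewrite expfzDr ?gt_eqF // exprN1.
have sub : padic_ball s (r / p%:R) `<=` padic_ball s r.
  by move=> x /le_trans; apply; rewrite ler_pdivrMr // ler_pMr // ltW.
rewrite padic_sphereE // measureD //=; first last.
- by rewrite mub // ltry.
- by apply: measurable_padic_ball; rewrite divr_gt0.
- exact: measurable_padic_ball.
rewrite setIidr // !mub // -EFinB; congr (_%:E); ring.
Qed.

(* Since spheres are Borel in Q_p, the Borel sets of padic_sphere s r are the
   Borel sets of Q_p contained in it. *)
Definition sphere_haar (mubar : {measure set Qp -> \bar R}) (s : Qp) (r : R)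
    (A : set Qp) : \bar R :=
  (mubar (A `&` padic_sphere s r) / mubar (padic_sphere s r))%E.

(* The division by zero at the pole x = - c returns 0; that point lies on none
   of the spheres considered. *)
Definition quad_map (a b c x : Qp) : Qp := (x ^+ 2 + a * x + b) / (x + c).

Lemma quad_map_fixedP (a b c x : Qp) : a != c -> x != - c ->
  quad_map a b c x = x <-> x = b / (c - a).
Proof.
move=> ac xc; have ca : c - a != 0 by rewrite subr_eq0 eq_sym.
have xc0 : x + c != 0 by rewrite addr_eq0.
have E : (x ^+ 2 + a * x + b == x * (x + c)) = (x * (c - a) == b).
  rewrite -subr_eq0 -[RHS]subr_eq0 -[RHS]oppr_eq0.
  by congr (_ == 0); ring.
have -> : (quad_map a b c x = x) <-> (x ^+ 2 + a * x + b == x * (x + c)).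
  rewrite /quad_map; split=> [/(congr1 ( *%R^~ (x + c))) /=|/eqP ->].
    by rewrite divfK // => ->.
  by rewrite mulfK.
by rewrite E; split=> [/eqP <-|->]; rewrite ?mulfK ?divfK.
Qed.

Lemma quad_map_fixed_neq_pole (a b c : Qp) :
  a != c -> c ^+ 2 - a * c + b != 0 -> b / (c - a) != - c.
Proof.
move=> ac h; have ca : c - a != 0 by rewrite subr_eq0 eq_sym.
apply: contraNneq h => E; have -> : b = - c * (c - a) by rewrite -E divfK.
by apply/eqP; ring.
Qed.

Definition I1 (alpha beta : R) : set R :=
  [set r | 0 < r /\ alpha != beta /\ r > Num.max alpha beta].

Definition I2 (alpha beta : R) : set R :=
  [set r | 0 < r /\ alpha = beta /\ r != beta].

End Dynamics.

Definition ergodic d (T : measurableType d) (R : realType)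
    (X : set T) (f : T -> T) (mu : set T -> \bar R) : Prop :=
  forall V : set T, measurable V -> V `<=` X -> f @` V `<=` V ->
    mu V = 0%E \/ mu V = 1%E.

(* Main.v *)
(** On the sphere, f x - x = (a - c) (x - x0) / (x + c), and in every case of
    the theorem |a - c| < |x + c|.  Hence f moves each point of the sphere of
    radius r by less than r, i.e. by at most r / p, so every ball of radius
    r / p in the sphere is invariant.  Its normalized measure 1 / (p - 1) is
    neither 0 nor, because p >= 3, equal to 1. *)
Require Import Defs.
From mathcomp Require Import all_boot all_order all_algebra.
From mathcomp Require Import all_classical all_reals all_analysis.
From mathcomp Require Import ring lra zify.

Set Implicit Arguments.
Unset Strict Implicit.
Unset Printing Implicit Defensive.

Import Order.TTheory GRing.Theory Num.Theory.
Import numFieldNormedType.Exports.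

Local Open Scope classical_set_scope.
Local Open Scope ring_scope.

(** Writing [y] as [- x + (x + y)] bounds its norm by the larger of the norms of [x] and [x + y],
    and the first cannot be the larger. *)
Lemma padic_normDl (R : realType) (p : nat) (p_prime : prime p)
    (x y : padic R p_prime) :
  padic_norm x < padic_norm y -> padic_norm (x + y) = padic_norm y.
Proof.
move=> xy; apply/eqP; rewrite eq_le; apply/andP; split.
  by apply: le_trans (padic_normD_max x y) _; rewrite ge_max lexx ltW.
have := padic_normD_max (- x) (x + y).
by rewrite addKr padic_normN le_max (leNgt _ (padic_norm x)) xy.
Qed.

(** Nonzero norms are integer powers of [p], so the largest one below [r] is [r / p]. *)
Lemma padic_norm_lt_value (R : realType) (p : nat) (p_prime : prime p)
    (x : padic R p_prime) (r : R) :
  padic_value p r -> padic_norm x < r -> padic_norm x <= r / p%:R.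
Proof.
move=> [k ->]; have p1 : (1 : R) < p%:R by rewrite ltr1n prime_gt1.
have p0 : (0 : R) < p%:R by rewrite (lt_trans ltr01).
have [->|x0] := eqVneq x 0; first by rewrite padic_norm0 divr_ge0 ?exprz_ge0 ?ltW.
have [j ->] := padic_norm_value x0.
have -> : p%:R ^ k / p%:R = p%:R ^ (k - 1) :> R.
  by rewrite expfzDr ?gt_eqF // exprN1.
by rewrite ltr_eXz2l // ler_eXz2l //; lia.
Qed.

Lemma small_displacement_not_ergodic (R : realType) (p : nat)
    (p_prime : prime p) (p_ge3 : (3 <= p)%N) (f : padic R p_prime -> padic R p_prime)
    (mubar : {measure set (padic R p_prime) -> \bar R})
    (mubar_haar : is_padic_haar mubar) (s : padic R p_prime)
    (r : R) (r_value : padic_value p r) :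
  (forall x, padic_sphere s r x -> padic_norm (f x - x) < r) ->
  ~ ergodic (padic_sphere s r) f (sphere_haar mubar s r).
Proof.
move=> fr erg; have p3 : (3 : R) <= p%:R by rewrite ler_nat.
have p0 : (0 : R) < p%:R by lra.
have r0 : 0 < r by have [k ->] := r_value; rewrite exprz_gt0.
have rp0 : 0 < r / p%:R by rewrite divr_gt0.
have rp_lt : r / p%:R < r by rewrite ltr_pdivrMr // ltr_pMr //; lra.
have rp_value : padic_value p (r / p%:R).
  by have [k ->] := r_value; exists (k - 1); rewrite expfzDr ?gt_eqF // exprN1.
have muS := padic_haar_sphere s mubar_haar r_value.
have pV1 : p%:R^-1 < 2^-1 :> R by rewrite ltf_pV2 ?posrE //; lra.
have S0 : 0 < r * (1 - p%:R^-1) by rewrite mulr_gt0 //; lra.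
(* A sphere of positive measure has a point. *)
have [y yS] : padic_sphere s r !=set0.
  by apply/set0P/eqP => E; move: muS; rewrite E measure0 => -[]; lra.
(* Moving [y] by less than [r] leaves its distance to [s] unchanged. *)
have VS : padic_ball y (r / p%:R) `<=` padic_sphere s r.
  move=> x xy; rewrite /padic_sphere /= -yS -(subrK y x) -addrA padic_normDl //.
  by rewrite yS (le_lt_trans xy).
have fV : f @` padic_ball y (r / p%:R) `<=` padic_ball y (r / p%:R).
  move=> _ [x xV <-]; rewrite /padic_ball /= -(subrK x (f x)) -addrA.
  apply: le_trans (padic_normD_max _ _) _; rewrite ge_max xV andbT.
  by apply: padic_norm_lt_value => //; apply/fr/VS.
have := erg _ (measurable_padic_ball y rp0) VS fV.
rewrite /sphere_haar setIidl // muS mubar_haar.2 // inver gt_eqF //.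
rewrite -EFinM => -[] [] /eqP.
  by rewrite gt_eqF // divr_gt0.
(* Normalized measure 1 would mean [r / p = r * (1 - 1 / p)], but [1 / p < 1 / 2] makes the left
   side smaller; for [p = 2] they would coincide. *)
rewrite -(inj_eq (mulIf (lt0r_neq0 S0))) mul1r divfK ?lt0r_neq0 //.
by rewrite lt_eqF // ltr_pM2l //; lra.
Qed.

(** The numerator [x ^+ 2 + a * x + b - x * (x + c)] is affine in [x], with slope [a - c] and root
    the fixed point. *)
Lemma quad_fraction_displacement (F : fieldType) (a b c x : F) :
  a != c -> x + c != 0 ->
  (x ^+ 2 + a * x + b) / (x + c) - x = (a - c) * (x - b / (c - a)) / (x + c).
Proof.
move=> ac xc; have ca : c - a != 0 by rewrite subr_eq0 eq_sym.
by field; rewrite xc ca.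
Qed.

Theorem theorem3 (R : realType) (p : nat) (p_prime : prime p)
    (p_ge3 : (3 <= p)%N) (a b c : padic R p_prime)
    (a_neq_c : a != c) (no_fixed_pole : c ^+ 2 - a * c + b != 0)
    (mubar : {measure set (padic R p_prime) -> \bar R})
    (mubar_haar : is_padic_haar mubar)
    (r : R) (r_gt0 : 0 < r) (r_value : padic_value p r) :
  let f := quad_map a b c in
  let x0 := b / (c - a) in
  let alpha := padic_norm (x0 + a) in
  let beta := padic_norm (x0 + c) in
  let S := padic_sphere x0 r in
  let mu := sphere_haar mubar x0 r in
  (I1 alpha beta r -> ~ ergodic S f mu) /\
  (I2 alpha beta r ->
    (padic_norm (a - c) < beta -> ~ ergodic S f mu) /\
    (padic_norm (a - c) = beta -> r > beta -> ~ ergodic S f mu)).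
Proof.
move=> f x0 alpha beta S mu.
have suff_lt : (forall x, S x -> padic_norm (a - c) < padic_norm (x + c)) ->
    ~ ergodic S f mu.
  move=> H; apply: small_displacement_not_ergodic => // x xS.
  have acx := H x xS.
  (* The strict bound also keeps [x] away from the pole. *)
  have xc_gt0 := le_lt_trans (padic_norm_ge0 _) acx.
  have xc : x + c != 0.
    by apply: contraTneq xc_gt0 => ->; rewrite padic_norm0 ltxx.
  rewrite -(ltr_pM2r xc_gt0) -padic_normM /f /quad_map.
  rewrite quad_fraction_displacement // divfK //.
  by rewrite padic_normM -/x0 xS mulrC ltr_pM2l.
(* In [x + c = (x - x0) + (x0 + c)] the summands have norms [r] and [beta]; the larger one wins. *)
have far x : beta < r -> S x -> padic_norm (x + c) = r.
  move=> br xS; have -> : x + c = (x0 + c) + (x - x0) by ring.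
  by rewrite padic_normDl xS.
have near x : r < beta -> S x -> padic_norm (x + c) = beta.
  move=> br xS; have -> : x + c = (x - x0) + (x0 + c) by ring.
  by rewrite padic_normDl ?xS.
split=> [[_ [_]]|[_ [_ r_neq]]].
  rewrite gt_max => /andP[ar br]; apply: suff_lt => x xS; rewrite far //.
  (* Hence the norm of [a - c] is at most the maximum of [alpha] and [beta]. *)
  have -> : a - c = (x0 + a) - (x0 + c) by ring.
  by apply: le_lt_trans (padic_normD_max _ _) _; rewrite gt_max padic_normN ar.
split=> [ac|ac br]; apply: suff_lt => x xS; last by rewrite far // ac.
(* Either way the norm of [x + c] is at least [beta]. *)
have [rb|br|/eqP] := ltgtP r beta; last by rewrite (negPf r_neq).
  by rewrite near.
by rewrite far // (lt_trans ac).
Qed.
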